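(* $L(5)=8$, $L(6)\le 16$, $L(7)\le 28$, and, as $d\to\infty$, $$L(d)\le (c+o(1))\binom{d}{\lfloor d/2\rfloor},$$ where $$c=\lim_{t\to\infty}\frac{(2^t-2)(2^t-4)\cdots(2^t-2^{t-1})}{(2^t-1)^{t-1}}$$ (which is roughly $0.29$), and the $o(1)$-term tends to $0$ as $d\to\infty$.
   Context: A set $\mathcal{C}\subseteq\{0,1\}^n$ is a $(d,L,n)$-code (a $(d,L)$-list decodable erasure code of length $n$) if every $d$-dimensional subcube of $\{0,1\}^n$ (a set obtained by fixing the values of some $n-d$ coordinates and letting the other $d$ coordinates vary freely) contains at most $L$ elements of $\mathcal{C}$; equivalently, for every codeword, after erasing any $d$ of its bits the remaining part has at most $L$ completions to codewords. $L(d)$ denotes the smallest integer $L$ for which there exists $\varepsilon=\varepsilon(d)>0$ such that for every $n$ there is a $(d,L,n)$-code of cardinality at least $\varepsilon 2^n$. *)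

(* Defs.v *)
From HB Require Import structures.
From mathcomp Require Import all_boot all_order all_algebra.
From mathcomp Require Import all_classical all_reals all_analysis.

Set Implicit Arguments.
Unset Strict Implicit.
Unset Printing Implicit Defensive.

Import Order.TTheory GRing.Theory Num.Theory.
Import numFieldNormedType.Exports.

Local Open Scope ring_scope.

Definition cube (n : nat) : finType := {ffun 'I_n -> bool}.

(* [S] is the set of free coordinates, so the subcube has dimension [#|S|];
   the coordinates outside [S] are fixed to the values they have in [x]. *)
Definition subcube (n : nat) (S : {set 'I_n}) (x : cube n) : {set cube n} :=
  [set y : cube n | [forall i, (i \notin S) ==> (y i == x i)]].

Definition is_code (d L n : nat) (C : {set cube n}) : Prop :=
  forall (S : {set 'I_n}) (x : cube n),
    #|S| = d -> (#|C :&: subcube S x| <= L)%N.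

Definition has_dense_codes (R : realType) (d L : nat) : Prop :=
  exists eps : R, 0 < eps /\
    forall n : nat, exists C : {set cube n},
      is_code d L C /\ eps * 2 ^+ n <= #|C|%:R.

Lemma card_subcube (n : nat) (S : {set 'I_n}) (x : cube n) :
  (#|subcube S x| <= 2 ^ #|S|)%N.
Proof.
pose f (y : cube n) : {set 'I_n} := [set i in S | y i].
rewrite -card_powerset -(card_in_imset (f := f)).
  apply/subset_leq_card/fintype.subsetP => _ /imsetP[y _ ->].
  by rewrite inE; apply/fintype.subsetP => i; rewrite inE => /andP[].
move=> y z; rewrite !inE => /forallP yx /forallP zx /finset.setP fyz.
apply/ffunP => i; have := fyz i; rewrite !inE.
case: (boolP (i \in S)) => //= iS _.
have := yx i; have := zx i.
by rewrite iS /= => /eqP-> /eqP->.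
Qed.

(* The full cube shows that the minimum defining [Lmin] is over a nonempty set. *)
Lemma has_dense_codes_ex (R : realType) (d : nat) :
  exists L, `[< has_dense_codes R d L >].
Proof.
exists (2 ^ d)%N; apply/asboolP; exists 1; split=> // n.
exists [set: cube n]; split.
  by move=> S x <-; rewrite finset.setTI card_subcube.
by rewrite mul1r cardsT card_ffun card_bool card_ord natrX.
Qed.

Definition Lmin (R : realType) (d : nat) : nat :=
  ex_minn (has_dense_codes_ex R d).

Definition c_seq (R : realType) (t : nat) : R :=
  (\prod_(1 <= i < t) (2 ^+ t - 2 ^+ i)) / (2 ^+ t - 1) ^+ t.-1.

(* Main.v *)
Require Import Defs.
From HB Require Import structures.
From mathcomp Require Import all_boot all_order all_algebra.
From mathcomp Require Import zify ring lra.
From mathcomp Require Import reals.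

Set Implicit Arguments.
Unset Strict Implicit.
Unset Printing Implicit Defensive.

Import Order.TTheory GRing.Theory Num.Theory.

Local Open Scope ring_scope.

(** Upper bounds. Attach a vector of F_2^r to every coordinate, keep the words of
    weight r whose support indexes a basis, and do this for all r in one residue
    class mod d + 1. Random vectors give a basis with probability > 1/4, so this
    has positive density. A d-dimensional subcube meets a single such layer: its
    codewords are the t-subsets of a d-set D that complete a fixed independent
    set S to a basis. Deleting an element of D, or moving it to S, shows by
    averaging that the maximal number of completions divided by 'C(d, t) does not
    increase from (d, t) to (d + 1, t) or (d + 1, t + 1). For fixed t the number
    of ordered bases among d vectors of F_2^t is at most [c_seq t * d ^ t], the
    uniform distribution on nonzero vectors being optimal. Hence 5 completions
    for (4, 2), which propagates to 8, 16, 28 for d = 5, 6, 7, and the bound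
    (c + o(1)) 'C(d, t) when t and d - t are both large.

    Lower bound. In a dense code take a translate x for which many of the words
    "x plus a transversal of K blocks of coordinates that omits block i" are in
    the code. Some three blocks i1, i2, i3 can then be omitted simultaneously for
    a positive proportion of transversals, and varying the transversal in the
    first two blocks yields a copy of the complete tripartite graph K(2,2,1),
    that is, 8 codewords in a 5-dimensional subcube. *)

(** * Completing an independent set to a basis *)

Lemma disjointsU1 (T : finType) (x : T) (P Q : {set T}) :
  [disjoint x |: P & Q] = (x \notin Q) && [disjoint P & Q].
Proof. by rewrite !disjoints_subset subUset sub1set inE. Qed.

Section Completions.

Variables (n r : nat) (A : 'M['F_2]_(n, r)).
Implicit Types (S D P Y : {set 'I_n}) (x y : 'I_n).

Definition rspan P : 'M['F_2]_r := (\sum_(i in P) <<row i A>>)%MS.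

Definition is_basis P := (#|P| == r) && row_full (rspan P).

(** In matroid terms, the bases of the contraction by [S] that lie inside [D], when [S] is
    independent and the rows of [A] span the space. *)
Definition completions S D :=
  [set Y : {set 'I_n} | [&& Y \subset D, [disjoint Y & S] & is_basis (S :|: Y)]].

Lemma row_sub_rspan P x : x \in P -> (row x A <= rspan P)%MS.
Proof. by move=> xP; apply: (sumsmx_sup x); rewrite ?genmxE. Qed.

Lemma rspan_subP P m (W : 'M_(m, r)) :
  reflect (forall x, x \in P -> (row x A <= W)%MS) (rspan P <= W)%MS.
Proof.
apply: (iffP sumsmx_subP) => PW x xP; first by rewrite -genmxE PW.
by rewrite genmxE PW.
Qed.

Lemma rspanS P Y : P \subset Y -> (rspan P <= rspan Y)%MS.
Proof.
by move/subsetP=> PY; apply/rspan_subP => x /PY xY; apply: row_sub_rspan.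
Qed.

Lemma rank_rspan P : (\rank (rspan P) <= #|P|)%N.
Proof.
rewrite -sum1_card /rspan.
elim/big_rec2: _ => [|i k M _ le_kM]; first by rewrite mxrank0.
apply: leq_trans (mxrank_adds_leqif _ _) _.
by rewrite leq_add // mxrank_gen rank_leq_row.
Qed.

Lemma rank_rspanU P Y : (\rank (rspan (P :|: Y)) <= \rank (rspan P) + #|Y|)%N.
Proof.
apply: leq_trans (leq_add (leqnn _) (rank_rspan Y)).
apply: leq_trans (mxrank_adds_leqif _ _).
apply: mxrankS; apply/rspan_subP => x /setUP[] xP.
  exact: submx_trans (row_sub_rspan xP) (addsmxSl _ _).
exact: submx_trans (row_sub_rspan xP) (addsmxSr _ _).
Qed.

Lemma card_completion S D Y t :
  (#|S| + t)%N = r -> Y \in completions S D -> #|Y| = t.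
Proof.
move=> rE; rewrite inE => /and3P[_ YS /andP[/eqP cSY _]].
move: cSY; rewrite -[RHS]rE cardsU disjoint_setI0 1?disjoint_sym // cards0 subn0.
by move/addnI.
Qed.

Lemma card_completions_le S D t :
  (#|S| + t)%N = r -> (#|completions S D| <= 'C(#|D|, t))%N.
Proof.
move=> rE; rewrite -cards_draws; apply/subset_leq_card/subsetP => Y cY.
by rewrite inE (card_completion rE cY) eqxx andbT; move: cY; rewrite inE; case/andP.
Qed.

(** Adding [t] rows to a span of rank below [#|S|] cannot reach rank [r]. *)
Lemma completions_indep S D t :
  (#|S| + t)%N = r -> (\rank (rspan S) < #|S|)%N -> completions S D = set0.
Proof.
move=> rE rkS; apply/setP => Y; rewrite [RHS]inE; apply/negbTE/negP => cY.
have cardY := card_completion rE cY.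
move: cY; rewrite inE => /and3P[_ _ /andP[_]].
rewrite /row_full => /eqP rk.
have := rank_rspanU S Y; rewrite rk cardY; lia.
Qed.

Lemma card_completionsU1 S D x : x \in D :\: S ->
  #|completions (x |: S) D| = #|[set Y in completions S D | x \in Y]|.
Proof.
rewrite inE => /andP[xS xD].
have inj : {in completions (x |: S) D &, injective (fun Y => x |: Y)}.
  move=> Y Z; rewrite !inE => /and3P[_ dY _] /and3P[_ dZ _] E.
  have xY : x \notin Y by rewrite (disjointFl dY) // setU11.
  have xZ : x \notin Z by rewrite (disjointFl dZ) // setU11.
  by rewrite -(setU1K xY) -(setU1K xZ) E.
rewrite -(card_in_imset inj); apply: eq_card => Y.
apply/imsetP/idP => [[Z cZ ->]|].
  move: cZ; rewrite !inE eqxx andbT => /and3P[ZD dZ bZ].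
  have dZ' := dZ; rewrite disjoint_sym disjointsU1 // in dZ'.
  case/andP: dZ' => xZ dZ'.
  rewrite subUset sub1set xD ZD /= disjointsU1 xS /= disjoint_sym dZ' /=.
  by rewrite setUCA setUA.
rewrite inE => /andP[]; rewrite inE => /and3P[YD dY bY] xY.
exists (Y :\ x); last by rewrite setD1K.
rewrite inE (subset_trans (subsetDl _ _) YD) /=.
rewrite -setUA (setUC S) setUA setD1K // (setUC Y) bY andbT.
rewrite disjoint_sym disjointsU1 setD11 /= disjoint_sym.
by apply: disjointWl dY; apply: subsetDl.
Qed.

(** Double counting of pairs [x \in Y]: moving [x] to [S] counts the completions containing [x], and
    each completion has [t] elements. *)
Lemma sum_completionsU1 S D t : (#|S| + t)%N = r ->
  (\sum_(x in D :\: S) #|completions (x |: S) D| = t * #|completions S D|)%N.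
Proof.
move=> rE.
transitivity (\sum_(x in D :\: S) \sum_(Y in completions S D) (x \in Y))%N.
  apply: eq_bigr => x xDS; rewrite card_completionsU1 // -sum1_card.
  rewrite [RHS](bigID (fun Y : {set 'I_n} => x \in Y)) /= [X in (_ + X)%N]big1 ?addn0.
    by apply: eq_big => [Y|Y]; rewrite !inE // => /andP[_ ->].
  by move=> Y /andP[_ /negbTE->].
rewrite exchange_big /= mulnC -sum_nat_const; apply: eq_bigr => Y cY.
rewrite -(card_completion rE cY) -sum1_card.
move: cY; rewrite inE => /and3P[/subsetP YD dY _].
rewrite (bigID (fun x => x \in Y)) /= [X in (_ + X)%N]big1 ?addn0; last first.
  by move=> x /andP[_ /negbTE->].
apply: eq_big => [x|x /andP[_ ->] //].
rewrite inE; case xY: (x \in Y); rewrite ?andbF // andbT.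
by rewrite (YD _ xY) (disjointFr dY).
Qed.

Lemma completionsD1 S D x :
  completions S (D :\ x) = [set Y in completions S D | x \notin Y].
Proof.
apply/setP => Y; rewrite !inE subsetD1.
by case: (Y \subset D); case: (x \in Y); rewrite ?andbF ?andbT.
Qed.

Lemma sum_completionsD1 S D t : (#|S| + t)%N = r ->
  (\sum_(x in D) #|completions S (D :\ x)| = (#|D| - t) * #|completions S D|)%N.
Proof.
move=> rE.
transitivity (\sum_(x in D) \sum_(Y in completions S D) (x \notin Y))%N.
  apply: eq_bigr => x xDS; rewrite completionsD1 // -sum1_card.
  rewrite [RHS](bigID (fun Y : {set 'I_n} => x \notin Y)) /= [X in (_ + X)%N]big1 ?addn0.
    by apply: eq_big => [Y|Y]; rewrite !inE // => /andP[_ ->].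
  by move=> Y /andP[_ /negbTE->].
rewrite exchange_big /= mulnC -sum_nat_const; apply: eq_bigr => Y cY.
have cardY := card_completion rE cY.
move: cY; rewrite inE => /and3P[YD dY _].
have -> : (#|D| - t)%N = #|D :\: Y| by rewrite cardsD (setIidPr YD) cardY.
rewrite -sum1_card.
rewrite (bigID (fun x => x \notin Y)) /= [X in (_ + X)%N]big1 ?addn0; last first.
  by move=> x /andP[_ /negbTE->].
by apply: eq_big => [x|x /andP[_ ->] //]; rewrite !inE andbC.
Qed.

End Completions.

(** * Averaging over deletions and contractions; an inequality for class sizes *)

Section CompletionRatio.

Variable R : realFieldType.

(** Uniform over all matrices and all [S], so that the bound can be applied again after an element
    is deleted or contracted. *)
Definition completions_le (rho : R) (d t : nat) :=
  forall n r (A : 'M['F_2]_(n, r)) (S D : {set 'I_n}),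
    #|D| = d -> [disjoint S & D] -> (#|S| + t)%N = r ->
    #|completions A S D|%:R <= rho * 'C(d, t)%:R.

(** Average over the deleted element, with [(d + 1 - t) 'C(d + 1, t) = (d + 1) 'C(d, t)]. *)
Lemma completions_le_del rho d t :
  (t <= d)%N -> completions_le rho d t -> completions_le rho d.+1 t.
Proof.
move=> le_td H n r A S D cD dis rE.
have ub : (\sum_(x in D) #|completions A S (D :\ x)|)%:R
    <= d.+1%:R * (rho * 'C(d, t)%:R).
  rewrite natr_sum -cD mulr_natl -sumr_const; apply: ler_sum => x xD.
  apply: H => //; first by have := cardsD1 x D; rewrite xD cD => -[].
  by apply: disjointWr dis; apply: subsetDl.
rewrite (sum_completionsD1 _ _ rE) cD natrM in ub.
have E := mul_bin_down d.+1 t; rewrite /= in E.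
rewrite mulrCA -[X in _ <= _ * X]natrM E natrM mulrCA ler_pM2l // in ub.
by rewrite ltr0n subn_gt0 ltnS.
Qed.

(** Average over the element moved to [S], with [(t + 1) 'C(d + 1, t + 1) = (d + 1) 'C(d, t)]. *)
Lemma completions_le_contr rho d t :
  completions_le rho d t -> completions_le rho d.+1 t.+1.
Proof.
move=> H n r A S D cD dis rE.
have DS : D :\: S = D by apply/setDidPl; rewrite disjoint_sym.
have ub : (\sum_(x in D :\: S) #|completions A (x |: S) D|)%:R
    <= d.+1%:R * (rho * 'C(d, t)%:R).
  rewrite natr_sum DS -cD mulr_natl -sumr_const; apply: ler_sum => x xD.
  have xS : x \notin S by rewrite (disjointFl dis).
  have -> : completions A (x |: S) D = completions A (x |: S) (D :\ x).
    apply/setP => Y; rewrite !inE subsetD1 (disjoint_sym Y) disjointsU1.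
    by case: (x \in Y); rewrite /= ?andbF ?andbT.
  apply: H; first by have := cardsD1 x D; rewrite xD cD => -[].
    rewrite disjointsU1 setD11 /=.
    by apply: disjointWr dis; apply: subsetDl.
  by rewrite cardsU1 xS -rE; lia.
rewrite (sum_completionsU1 _ _ rE) natrM in ub.
have E := mul_bin_diag d.+1 t; rewrite /= in E.
by rewrite mulrCA -[X in _ <= _ * X]natrM E natrM mulrCA ler_pM2l ?ltr0n in ub.
Qed.

(* [y ^+ m * (1 - y)] stays below its tangent at [a] as soon as
   [a] lies to the right of its inflexion point [(m - 1) / m]. *)
Lemma expr_onem_le_tangent m (a y : R) :
  0 <= y -> 0 <= a <= 1 -> m%:R - 1 <= m%:R * a ->
  y ^+ m * (1 - y) <=
    a ^+ m * (1 - a) + (m%:R * a ^+ m.-1 - m.+1%:R * a ^+ m) * (y - a).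
Proof.
move=> y0 /andP[a0 a1]; elim: m => [|m IH] ma; first by rewrite !expr0; lra.
have ma' : m%:R - 1 <= m%:R * a by rewrite -natr1 in ma; lra.
have {}IH := ler_wpM2l y0 (IH ma').
have am : 0 <= a ^+ m by rewrite exprn_ge0.
have E : m%:R * a ^+ m.-1 * a = m%:R * a ^+ m.
  by case: m {IH ma ma' am} => [|m]; rewrite ?mul0r //= exprSr mulrA.
have slope : m%:R * a ^+ m.-1 <= m.+1%:R * a ^+ m.
  case: m {IH ma' E} ma am => [|m] ma am; first by rewrite mul0r mulr_ge0.
  rewrite /= exprSr mulrCA mulrC ler_wpM2l ?exprn_ge0 //.
  by rewrite -natr1 in ma; lra.
rewrite exprS -mulrA; apply: le_trans IH _; rewrite /= !exprSr.
set s := m%:R * a ^+ m.-1 in slope E *; set p := a ^+ m in am slope E *.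
rewrite -subr_ge0.
(* The tangent for [m + 1] exceeds [y] times the tangent for [m] by a nonnegative multiple of
   [(y - a) ^+ 2]. *)
have -> : p * a * (1 - a) + (m.+1%:R * p - m.+2%:R * (p * a)) * (y - a) -
     y * (p * (1 - a) + (s - m.+1%:R * p) * (y - a))
   = (m.+1%:R * p - s) * (y - a) ^+ 2.
  by rewrite -!natr1; ring: E.
by rewrite mulr_ge0 ?sqr_ge0 // subr_ge0.
Qed.

(* The bound is attained at equal weights: it is the sum of the tangents at
   [1 - #|Z|^-1]. *)
Lemma sum_fibers_le (I : finType) (Z : {set I}) (x : I -> R) m :
  (m <= #|Z|)%N -> (forall z, z \in Z -> 0 <= x z) ->
  \sum_(z in Z) x z * (\sum_(w in Z) x w - x z) ^+ m
    <= (1 - #|Z|%:R^-1) ^+ m * (\sum_(w in Z) x w) ^+ m.+1.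
Proof.
move=> le_mZ x0; set K := \sum_(w in Z) x w.
have K0 : 0 <= K by apply: sumr_ge0.
have xK z : z \in Z -> x z <= K.
  by move=> zZ; rewrite /K (bigD1 z) //= lerDl sumr_ge0 // => w /andP[/x0].
have [K_eq0|K_neq0] := eqVneq K 0.
  rewrite K_eq0 expr0n mulr0 big1 // => z zZ.
  have -> : x z = 0 by apply/le_anti; rewrite x0 // -K_eq0 xK.
  by rewrite mul0r.
have Kpos : 0 < K by rewrite lt_neqAle eq_sym K_neq0.
have Zpos : (0 < #|Z|)%N.
  rewrite lt0n; apply: contra_neq K_neq0 => Z0.
  by rewrite /K (cards0_eq Z0) big_set0.
pose N : R := #|Z|%:R; have N1 : 1 <= N by rewrite ler1n.
have Npos : 0 < N by lra.
pose a := 1 - N^-1.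
have a01 : 0 <= a <= 1.
  by rewrite subr_ge0 invf_le1 // N1 lerBlDr lerDl invr_ge0 ltW.
(* [m <= #|Z|] puts the equal-weight point to the right of [(m - 1) / m]. *)
have ma : m%:R - 1 <= m%:R * a.
  rewrite mulrBr mulr1 lerD2l lerN2 ler_pdivrMr // mul1r.
  by rewrite ler_nat.
pose s := m%:R * a ^+ m.-1 - m.+1%:R * a ^+ m.
rewrite -/N -/a; pose y z := (K - x z) / K.
have -> : \sum_(z in Z) x z * (K - x z) ^+ m =
  K ^+ m.+1 * \sum_(z in Z) y z ^+ m * (1 - y z).
  rewrite mulr_sumr; apply: eq_bigr => z zZ.
  rewrite /y exprMn exprVn exprSr.
  have -> : 1 - (K - x z) / K = x z / K by field.
  by field; rewrite K_neq0 expf_neq0.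
rewrite mulrC ler_wpM2r ?exprn_ge0 //.
apply: le_trans (_ : \sum_(z in Z) (a ^+ m * (1 - a) + s * (y z - a)) <= _).
  apply: ler_sum => z zZ; apply: expr_onem_le_tangent => //.
  by rewrite divr_ge0 // subr_ge0 xK.
rewrite big_split /= sumr_const -mulr_sumr sumrB sumr_const.
(* The points [y z] have mean [a], so the linear terms of the tangents cancel. *)
have -> : \sum_(z in Z) y z = N - 1.
  rewrite /y -mulr_suml sumrB sumr_const -/K -mulr_natl -/N.
  by field.
have scal (u : R) : u *+ #|Z| = N * u by rewrite mulr_natl.
rewrite !scal /a.
suff -> : N * ((1 - N^-1) ^+ m * (1 - (1 - N^-1))) +
    s * (N - 1 - N * (1 - N^-1)) = (1 - N^-1) ^+ m by [].
by field; rewrite lt0r_neq0.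
Qed.

End CompletionRatio.

(** * Ordered bases and the constants [c_seq] *)

Section Lagrangian.

Variable R : realType.

(** The recursion mirrors the choice of a first vector: [2 ^+ t.+1 - 1] counts the nonzero vectors
    of F_2^(t+1), and the new factor is the one in [sum_fibers_le]. *)
Lemma c_seqS t :
  c_seq R t.+1 = c_seq R t * (1 - (2 ^+ t.+1 - 1)^-1) ^+ t.
Proof.
case: (posnP t) => [->|t_gt0].
  by rewrite /c_seq !big_geq // !expr0 !mulr1.
rewrite /c_seq big_ltn //.
have p_gt0 k : (0 < k)%N -> 0 < 2 ^+ k - 1 :> R.
  by case: k => // k _; rewrite subr_gt0 exprn_egt1 // ltr1n.
have -> : \prod_(2 <= i < t.+1) (2 ^+ t.+1 - 2 ^+ i : R) =
          2 ^+ t.-1 * \prod_(1 <= i < t) (2 ^+ t - 2 ^+ i).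
  rewrite (big_addn 1 t.+1 1) subn1 /=.
  have -> : 2 ^+ t.-1 = \prod_(1 <= i < t) 2 :> R.
    by rewrite prodr_const_nat subn1.
  by rewrite -big_split /=; apply: eq_bigr => i _; rewrite addn1 !exprS mulrBr.
have := p_gt0 t t_gt0; have := p_gt0 t.+1 isT.
case: t t_gt0 => // t _ /=; rewrite expr1 exprS.
set q := 2 ^+ t.+1; set P := \prod_(_ <= i < _) _ => pos1 pos2.
have -> : 1 - (2 * q - 1)^-1 = (2 * (q - 1)) / (2 * q - 1).
  by field; rewrite lt0r_neq0.
rewrite exprMn exprMn exprVn (exprS 2 t) (exprS (q - 1)).
by field; rewrite ?expf_neq0 ?lt0r_neq0.
Qed.

Lemma c_seq_ge0 t : 0 <= c_seq R t.
Proof.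
elim: t => [|t IH]; first by rewrite /c_seq big_geq // expr0 divr1.
rewrite c_seqS mulr_ge0 // exprn_ge0 // subr_ge0 invf_le1.
  by rewrite lerBrDr exprS mulr_natl mulr2n lerD // exprn_ege1 // ler1n.
by rewrite subr_gt0 exprn_egt1 // ltr1n.
Qed.

(** Non-loops of the contraction by [S], the only elements that can occur in a completion. *)
Definition nonloops n r (A : 'M['F_2]_(n, r)) (S D : {set 'I_n}) :=
  [set x in D | ~~ (row x A <= rspan A S)%MS].

(* [q] is reduction modulo the span of [S], with values in [F_2 ^ t]: its fibres
   over [Z], the nonzero vectors, are the parallel classes of the contraction. *)
Lemma parallel_classes n r (A : 'M['F_2]_(n, r)) (S D : {set 'I_n}) t :
  (#|S| + t)%N = r -> \rank (rspan A S) = #|S| ->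
  exists (I : finType) (Z : {set I}) (q : 'I_n -> I),
    [/\ #|Z| = (2 ^ t).-1,
        forall x, x \in nonloops A S D -> q x \in Z
      & forall x, x \in nonloops A S D ->
        nonloops A (x |: S) D \subset
          nonloops A S D :\: [set y in nonloops A S D | q y == q x]].
Proof.
move=> rE rkS; pose C := cokermx (rspan A S); pose q x := row x A *m col_base C.
have rkC : \rank C = t by rewrite mxrank_coker rkS -rE addKn.
have subE (u : 'rV_r) : (u <= rspan A S)%MS = (u *m col_base C == 0).
  rewrite submxE -/C -{1}(mulmx_base C) mulmxA.
  by rewrite -(mul0mx _ (row_base C)) (inj_eq (row_free_inj (row_base_free C))).
exists 'rV['F_2]_(\rank C), [set~ 0], q; split=> [|x|x].
- by rewrite cardsC1 card_mx card_Fp // mul1n rkC.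
- by rewrite !inE subE => /andP[].
rewrite inE => /andP[xD xS]; apply/subsetP => y; rewrite !inE => /andP[yD yxS].
have yS : ~~ (row y A <= rspan A S)%MS.
  apply: contra yxS => /submx_trans; apply; apply: rspanS.
  by apply: subsetUr.
rewrite yD yS /= andbT; apply: contra yxS => /eqP qyx.
have -> : row y A = (row y A - row x A) + row x A by rewrite subrK.
apply: addmx_sub; last by apply: row_sub_rspan; rewrite setU11.
apply: (submx_trans (n := r) (B := rspan A S)); last first.
  by apply: rspanS; apply: subsetUr.
by rewrite subE mulmxBl -/(q y) -/(q x) qyx subrr.
Qed.

(** Induction over the first vector [x] of an ordered completion: contracting [x] turns its whole
    parallel class into loops, and [sum_fibers_le] bounds the resulting sum over classes. *)
Lemma completions_lagrangian t n r (A : 'M['F_2]_(n, r)) (S D : {set 'I_n}) :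
  (#|S| + t)%N = r ->
  t`!%:R * #|completions A S D|%:R <= c_seq R t * #|nonloops A S D|%:R ^+ t.
Proof.
elim: t S => [|t IH] S rE.
  rewrite fact0 mul1r expr0 /c_seq big_geq // expr0 divr1 mulr1 (ler_nat _ _ 1).
  by have := card_completions_le A D rE; rewrite bin0.
have [rkS|rkS] := ltnP (\rank (rspan A S)) #|S|.
  by rewrite (completions_indep _ rE) // cards0 mulr0 mulr_ge0 ?c_seq_ge0 ?exprn_ge0.
have {}rkS : \rank (rspan A S) = #|S| by apply/eqP; rewrite eqn_leq rank_rspan.
have [I [Z [q [cZ qZ qN]]]] := parallel_classes D rE rkS.
set Nl := nonloops A S D in qZ qN *.
pose k z : R := #|[set y in Nl | q y == z]|%:R.
have sumk : \sum_(z in Z) k z = #|Nl|%:R.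
  rewrite -natr_sum -sum1_card (partition_big q (mem Z)) //=; congr (_%:R).
  apply: eq_bigr => z zZ; rewrite -sum1_card; apply: eq_bigl => y.
  by rewrite inE.
have ->: t.+1`!%:R * #|completions A S D|%:R =
    t`!%:R * (\sum_(x in D :\: S) #|completions A (x |: S) D|)%:R :> R.
  by rewrite (sum_completionsU1 _ _ rE) -!natrM factS; congr (_%:R); lia.
have NlS x : x \in Nl -> x \notin S.
  by rewrite inE => /andP[_]; apply: contra; apply: row_sub_rspan.
have -> : (\sum_(x in D :\: S) #|completions A (x |: S) D| =
          \sum_(x in Nl) #|completions A (x |: S) D|)%N.
  rewrite (bigID (mem Nl)) /= [X in (_ + X)%N]big1 ?addn0.
    apply: eq_bigl => x; rewrite inE andbC.
    by case xN: (x \in Nl) => //=; rewrite NlS //; move: xN; rewrite inE => /andP[].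
  (* A loop outside [S] cannot start a completion, because adding it makes [S] dependent. *)
  move=> x /andP[]; rewrite [x \in D :\: S]inE => /andP[xS xD] xN.
  have {xN} xl : (row x A <= rspan A S)%MS by apply: contraR xN; rewrite inE xD.
  have cU : #|x |: S| = #|S|.+1 by rewrite cardsU1 xS.
  apply/eqP; rewrite cards_eq0; apply/eqP; apply: (@completions_indep _ _ _ _ _ t).
    by rewrite cU addSnnS.
  rewrite cU ltnS -rkS; apply: mxrankS; apply/rspan_subP => y /setU1P[->//|].
  exact: row_sub_rspan.
apply: le_trans
    (_ : \sum_(x in Nl) c_seq R t * (#|Nl|%:R - k (q x)) ^+ t <= _).
  rewrite natr_sum mulr_sumr; apply: ler_sum => x xN.
  have cU : #|x |: S| = #|S|.+1 by rewrite cardsU1 NlS.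
  apply: le_trans (IH (x |: S) _) _; first by rewrite cU addSnnS.
  rewrite ler_wpM2l ?c_seq_ge0 //; apply: lerXn2r; rewrite ?nnegrE //.
    rewrite subr_ge0 ler_nat; apply: subset_leq_card.
    by apply/subsetP => y; rewrite inE => /andP[].
  have sub : [set y in Nl | q y == q x] \subset Nl.
    by apply/subsetP => y; rewrite inE => /andP[].
  rewrite -natrB ?subset_leq_card // ler_nat.
  by rewrite -(setIidPr sub) -cardsD; apply: subset_leq_card; apply: qN.
rewrite -mulr_sumr (partition_big q (mem Z)) //=.
have -> : \sum_(z in Z) \sum_(x in Nl | q x == z) (#|Nl|%:R - k (q x)) ^+ t =
    \sum_(z in Z) k z * (\sum_(w in Z) k w - k z) ^+ t.
  apply: eq_bigr => z zZ; rewrite sumk [in RHS]/k mulr_natl -[RHS]sumr_const -/(k z).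
  by apply: eq_big => [x|x /andP[_ /eqP->] //]; rewrite inE.
rewrite c_seqS -sumk -mulrA ler_wpM2l ?c_seq_ge0 //.
have -> : 2 ^+ t.+1 - 1 = #|Z|%:R :> R.
  by rewrite cZ -subn1 natrB ?expn_gt0 // natrX.
apply: sum_fibers_le => [|z _]; last by rewrite ler0n.
by rewrite cZ; have := ltn_expl t.+1 (isT : (1 < 2)%N); lia.
Qed.

Lemma completions_le_lagrangian d t rho : (t <= d)%N ->
  c_seq R t * d%:R ^+ t <= rho * (d ^_ t)%:R -> completions_le rho d t.
Proof.
move=> le_td cd n r A S D cD dis rE.
have tf : 0 < t`!%:R :> R by rewrite ltr0n fact_gt0.
rewrite -(ler_pM2l tf); apply: le_trans (completions_lagrangian A D rE) _.
apply: le_trans (_ : c_seq R t * d%:R ^+ t <= _).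
  rewrite ler_wpM2l ?c_seq_ge0 // lerXn2r ?nnegrE // ler_nat -cD.
  by apply/subset_leq_card/subsetP => y; rewrite inE => /andP[].
by apply: le_trans cd _; rewrite -bin_ffact mulnC natrM mulrCA.
Qed.

End Lagrangian.

(** * Dense families of bases *)

Lemma exists_ge_mean (T : finType) (f : T -> nat) (c : nat) :
  (0 < #|T|)%N -> (c * #|T| <= \sum_x f x)%N -> exists x, (c <= f x)%N.
Proof.
move=> T_gt0 le_sum; apply/existsP; apply: contraLR le_sum.
rewrite negb_exists -ltnNge => /forallP lt_f.
case: c lt_f => [|c] lt_f; first by case/card_gt0P: T_gt0 => x; have := lt_f x.
apply: (@leq_ltn_trans (\sum_(x : T) c)).
  by apply: leq_sum => x _; have := lt_f x; rewrite -ltnNge ltnS.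
by rewrite sum_nat_const mulSn mulnC -[X in (X < _)%N]add0n ltn_add2r.
Qed.

(** Double counting; each [act j] permutes [G]. It serves both for random matrices and for
    translates of a dense code. *)
Lemma sum_card_translates (G J : finType) (act : J -> G -> G) (X : {set G}) :
  (forall j, injective (act j)) ->
  (\sum_x #|[set j | act j x \in X]| = #|J| * #|X|)%N.
Proof.
move=> inj; transitivity (\sum_j \sum_x (act j x \in X))%N.
  rewrite exchange_big; apply: eq_bigr => x _.
  by rewrite -sum1_card big_mkcond; apply: eq_bigr => j _; rewrite inE; case: ifP.
rewrite -sum_nat_const; apply: eq_bigr => j _.
rewrite -(card_preimset _ (inj j)) -sum1_card [RHS]big_mkcond.
by apply: eq_bigr => x _; rewrite inE; case: ifP.
Qed.

(** A matrix of order [s + 1] is invertible with probability at least [1 / 4 + 1 / 2 ^ (s + 2)]; the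
    second term is what carries the induction. *)
Lemma card_GL2_ge s :
  (2 ^ (s.+1 * s.+1) * (2 ^ s + 1) <=
   2 ^ s.+2 * (2 ^ 'C(s.+1, 2) * \prod_(1 <= i < s.+2) (2 ^ i - 1)))%N.
Proof.
elim: s => [|s IH]; first by rewrite big_nat1.
rewrite big_nat_recr //= binS bin1.
move: (\prod_(_ <= i < _) _)%N 'C(_, _) IH => p b IH.
have -> : (s.+2 * s.+2 = s.+1 * s.+1 + (s + s + 3))%N by lia.
rewrite !expnD; set x := (2 ^ (s.+1 * s.+1))%N in IH *.
set c := (2 ^ b)%N in IH *.
have [E2 E3] : (2 ^ 3 = 8 /\ 2 ^ s.+1 = 2 * 2 ^ s)%N by split=> //; rewrite expnS.
rewrite E2 (expnS 2 s.+2) (expnS 2 s.+1) E3; rewrite (expnS 2 s.+1) E3 in IH.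
set a := (2 ^ s)%N in IH *.
have a1 : (0 < a)%N by rewrite expn_gt0.
case: a a1 IH => // k _ IH.
have -> : (2 * (2 * k.+1) - 1 = 4 * k + 3)%N by lia.
apply: (@leq_trans (4 * k.+1 * (4 * k + 3) * (x * (k.+1 + 1))))%N.
  have -> : (4 * k.+1 * (4 * k + 3) * (x * (k.+1 + 1)) =
             x * (4 * k.+1 * (4 * k + 3) * (k.+1 + 1)))%N by ring.
  by rewrite -mulnA leq_mul2l; apply/orP; right; nia.
apply: leq_trans (leq_mul (leqnn _) IH) _.
by rewrite leq_eqVlt; apply/orP; left; apply/eqP; ring.
Qed.

Lemma card_unitmx_F2 r :
  (2 ^ (r * r) <= 4 * #|[set B : 'M['F_2]_r | B \in unitmx]|)%N.
Proof.
case: r => [|s].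
  rewrite muln0 (leq_trans (_ : 1 <= 4)%N) // leq_pmulr // card_gt0.
  by apply/set0Pn; exists 1%:M; rewrite inE unitmx1.
have -> : #|[set B : 'M['F_2]_s.+1 | B \in unitmx]| = #|'GL_s.+1['F_2]%g|.
  rewrite cardsT /= card_sub; apply: eq_card => B; rewrite inE.
  by rewrite !unfold_in.
rewrite card_GL // card_Fp // -(leq_pmul2l (_ : 0 < 2 ^ s.+2)%N) ?expn_gt0 //.
rewrite mulnCA; apply: leq_trans (leq_mul (leqnn 4) (card_GL2_ge s)).
by rewrite !expnS; lia.
Qed.

(** Adding [E^T *m B] to [A] adds [B] to the block of rows indexed by [P]. For fixed [A] this block
    thus runs over all square matrices, of which at least a quarter are invertible. *)
Lemma card_basis_matrices n r (P : {set 'I_n}) : #|P| = r ->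
  (2 ^ (n * r) <= 4 * #|[set A : 'M['F_2]_(n, r) | is_basis A P]|)%N.
Proof.
move=> cP; subst r; pose f : 'I_#|P| -> 'I_n := @enum_val _ (mem P).
pose X := [set A : 'M['F_2]_(n, #|P|) | rowsub f A \in unitmx].
apply: leq_trans (_ : 4 * #|X| <= _)%N; last first.
  rewrite leq_mul2l; apply/orP; right; apply/subset_leq_card/subsetP => A.
  rewrite !inE /is_basis eqxx /= -row_full_unit -!sub1mx => full.
  apply: submx_trans full _; apply/row_subP => i; rewrite row_rowsub.
  by apply: row_sub_rspan; apply: enum_valP.
pose E : 'M['F_2]_(#|P|, n) := rowsub f 1%:M.
have EE : E *m E^T = 1%:M.
  apply/matrixP => i j; rewrite !mxE (bigD1 (f j)) //= !mxE eqxx mulr1 big1 ?addr0.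
    by rewrite (inj_eq enum_val_inj).
  by move=> k kj; rewrite !mxE [f j == k]eq_sym (negbTE kj) mulr0.
pose act (B : 'M['F_2]_#|P|) (A : 'M['F_2]_(n, #|P|)) := A + E^T *m B.
have inj B : injective (act B) by apply: addIr.
have := sum_card_translates X inj.
have -> : (\sum_x #|[set B | act B x \in X]| =
  \sum_(x : 'M['F_2]_(n, #|P|)) #|[set B : 'M['F_2]_#|P| | B \in unitmx]|)%N.
  apply: eq_bigr => A _.
  rewrite -[RHS](card_preimset _ (addrI (rowsub f A))).
  apply: eq_card => B; rewrite !inE /act.
  by rewrite rowsubE -/E mulmxDr mulmxA EE mul1mx -rowsubE.
rewrite sum_nat_const !card_mx !card_Fp // => H.
rewrite -(leq_pmul2l (_ : 0 < 2 ^ (#|P| * #|P|))%N) ?expn_gt0 // mulnCA -H.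
by rewrite mulnCA mulnC leq_mul // card_unitmx_F2.
Qed.

Lemma exists_many_bases n r : exists A : 'M['F_2]_(n, r),
  ('C(n, r) <= 4 * #|[set P : {set 'I_n} | is_basis A P]|)%N.
Proof.
apply: exists_ge_mean; first by rewrite card_mx card_Fp // expn_gt0.
rewrite -big_distrr /=.
have -> : (\sum_(A : 'M['F_2]_(n, r)) #|[set P : {set 'I_n} | is_basis A P]| =
  \sum_(P : {set 'I_n}) #|[set A : 'M['F_2]_(n, r) | is_basis A P]|)%N.
  under eq_bigr do rewrite -sum1_card big_mkcond /=.
  under [RHS]eq_bigr do rewrite -sum1_card big_mkcond /=.
  rewrite exchange_big /=; apply: eq_bigr => P _; apply: eq_bigr => A _.
  by rewrite !inE.
rewrite -[n in 'C(n, r)]card_ord -card_draws card_mx card_Fp // -sum_nat_const.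
rewrite big_distrr /= [leqRHS](bigID (mem [set P : {set 'I_n} | #|P| == r])) /=.
apply: leq_trans (leq_addr _ _); apply: leq_sum => P; rewrite inE => /eqP cP.
exact: card_basis_matrices.
Qed.

(** * Codes formed by layers of bases *)

Section BasisCodes.

Variables (n d : nat).

Definition ones (x : cube n) : {set 'I_n} := [set i | x i].

Lemma ones_inj : injective ones.
Proof. by move=> x y /setP xy; apply/ffunP => i; have := xy i; rewrite !inE. Qed.

Lemma ones_bij : bijective ones.
Proof.
exists (fun P : {set 'I_n} => [ffun i => i \in P]) => [x|P].
  by apply/ffunP => i; rewrite ffunE inE.
by apply/setP => i; rewrite inE ffunE.
Qed.

Definition many_bases r : 'M['F_2]_(n, r) := xchoose (exists_many_bases n r).

Definition basis_code (a : nat) : {set cube n} :=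
  ones @^-1: [set P : {set 'I_n} | (#|P| %% d.+1 == a)%N & is_basis (many_bases #|P|) P].

(** The residues together cover all layers, and layer [r] keeps at least a quarter of the ['C(n, r)]
    words of weight [r]. *)
Lemma sum_card_basis_code :
  (2 ^ n <= 4 * \sum_(a < d.+1) #|basis_code a|)%N.
Proof.
pose U := [set P : {set 'I_n} | is_basis (many_bases #|P|) P].
have -> : (\sum_(a < d.+1) #|basis_code a| = #|U|)%N.
  rewrite -sum1_card.
  rewrite (partition_big (fun P : {set 'I_n} => inord (#|P| %% d.+1) : 'I_d.+1) predT) //=.
  apply: eq_bigr => a _; rewrite (on_card_preimset (onW_bij _ ones_bij)) -sum1_card.
  apply: eq_bigl => P; rewrite !inE andbC -val_eqE /= inordK //.
  by rewrite ltn_pmod.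
have -> : (2 ^ n = \sum_(r < n.+1) 'C(n, r))%N.
  rewrite -[2%N]/(1 + 1)%N expnDn.
  by apply: eq_bigr => r _; rewrite !exp1n !muln1.
rewrite -sum1_card (partition_big (fun P : {set 'I_n} => inord #|P| : 'I_n.+1) predT) //=.
rewrite big_distrr /=; apply: leq_sum => r _.
apply: leq_trans (xchooseP (exists_many_bases n r)) _.
rewrite leq_mul2l /= -sum1_card; apply: eq_leq; apply: eq_bigl => P.
rewrite !inE -val_eqE /= inordK ?ltnS; last first.
  by rewrite -[X in (_ <= X)%N]card_ord max_card.
rewrite andbC; case: eqVneq => /= [<- //|neq].
by rewrite /is_basis (negbTE neq).
Qed.

(** [S0] is the fixed part of the support; a codeword [y] of the subcube is recovered from
    [ones y :&: S], which completes [S0] to a basis. *)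
Lemma basis_code_is_code a L :
  (forall t r (A : 'M['F_2]_(n, r)) (S D : {set 'I_n}), (t <= d)%N ->
    #|D| = d -> [disjoint S & D] -> (#|S| + t)%N = r ->
    (#|completions A S D| <= L)%N) ->
  is_code d L (basis_code a).
Proof.
move=> bound S x cS.
have [->|[y0]] := set_0Vmem (basis_code a :&: subcube S x).
  by rewrite cards0.
pose S0 := ones x :\: S.
have dis : [disjoint S0 & S] by rewrite disjoint_sym disjoints_subset setCD subsetUr.
have disS y : [disjoint S0 & ones y :&: S].
  by apply: disjointWr dis; apply: subsetIr.
have onesE y : y \in subcube S x -> ones y = S0 :|: (ones y :&: S).
  rewrite inE => /forallP yx; apply/setP => i; rewrite !inE.
  have := yx i; case: (i \in S) => /=; first by rewrite andbT.
  by move/eqP => ->; rewrite andbF orbF.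
have cardE y : y \in subcube S x -> #|ones y| = (#|S0| + #|ones y :&: S|)%N.
  move=> yx; rewrite {1}(onesE y yx) cardsU (disjoint_setI0 (disS y)).
  by rewrite cards0 subn0.
case/setIP => y0C y0x.
have le_d y : (#|ones y :&: S| <= d)%N.
  by rewrite -cS subset_leq_card ?subsetIr.
have card_eq y : y \in basis_code a -> y \in subcube S x ->
    #|ones y| = #|ones y0|.
  move=> yC yx; move: y0C yC; rewrite !inE => /andP[/eqP m0 _] /andP[/eqP m _].
  (* Both parts inside [S] have size at most [d], so congruence modulo [d + 1] forces equality. *)
  have /eqP := etrans m (esym m0); rewrite !cardE // eqn_modDl.
  by rewrite !modn_small ?ltnS // => /eqP->.
pose r := #|ones y0|.
have rE : (#|S0| + #|ones y0 :&: S|)%N = r by rewrite -cardE.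
apply: leq_trans (bound _ _ (many_bases r) _ _ (le_d y0) cS dis rE).
have inj : {in basis_code a :&: subcube S x &, injective (fun y => ones y :&: S)}.
  move=> y z /setIP[_ yx] /setIP[_ zx] yz; apply: ones_inj.
  by rewrite (onesE y) // yz -onesE.
rewrite -(card_in_imset inj); apply/subset_leq_card/subsetP => Y.
case/imsetP => y /setIP[yC yx] ->.
rewrite inE subsetIr /= -onesE // disjoint_sym disS /=.
move: (yC); rewrite inE inE => /andP[_]; rewrite /r.
by have := card_eq y yC yx; case: _ /.
Qed.

End BasisCodes.

Lemma dense_codes_of_completions (R : realType) d L :
  (forall t n r (A : 'M['F_2]_(n, r)) (S D : {set 'I_n}), (t <= d)%N ->
    #|D| = d -> [disjoint S & D] -> (#|S| + t)%N = r ->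
    (#|completions A S D| <= L)%N) ->
  has_dense_codes R d L.
Proof.
(* The factor 4 pays for the probability of a basis, [d.+1] for the choice of a residue class. *)
move=> bound; exists ((4 * d.+1)%:R^-1); split; first by rewrite invr_gt0 ltr0n.
move=> n; have [a le_a] : exists a : 'I_d.+1,
    (2 ^ n <= 4 * d.+1 * #|basis_code n d a|)%N.
  apply: exists_ge_mean; rewrite card_ord // -big_distrr /= mulnAC leq_mul2r.
  by rewrite sum_card_basis_code orbT.
exists (basis_code n d a); split.
  by apply: basis_code_is_code => t r A S D; apply: bound.
by rewrite mulrC ler_pdivrMr ?ltr0n // -natrX -natrM ler_nat mulnC.
Qed.

(** * Eight codewords in a subcube of dimension five *)

(** A proportion [eps / 2] of the points have at least [k] indices sending them into [A]. Each such
    point provides a [k]-set [T], and pigeonhole over at most [2 ^ #|I|] sets finds a frequent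
    one. *)
Lemma dense_common_translates (R : realFieldType) (G I : finType)
    (act : I -> G -> G) (A : {set G}) (eps : R) (k : nat) :
  (forall i, injective (act i)) -> 0 < eps -> (0 < k)%N -> (0 < #|G|)%N ->
  eps * #|G|%:R <= #|A|%:R -> (2 * k)%:R <= eps * #|I|%:R ->
  exists T : {set I}, #|T| = k /\
    eps / (2 * 2 ^+ #|I|) * #|G|%:R <=
      #|[set g | [forall (i | i \in T), act i g \in A]]|%:R.
Proof.
move=> inj eps_gt0 k_gt0 G_gt0 denseA bigI.
pose N g := [set i | act i g \in A].
pose Q := [set g | (k <= #|N g|)%N].
have I_gt0 : 0 < #|I|%:R :> R.
  rewrite -(pmulr_rgt0 _ eps_gt0); apply: lt_le_trans bigI.
  by rewrite ltr0n muln_gt0.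
have denseQ : eps / 2 * #|G|%:R <= #|Q|%:R.
  have sumN : #|I|%:R * #|A|%:R <= #|Q|%:R * #|I|%:R + k%:R * #|G|%:R :> R.
    rewrite -!natrM -natrD ler_nat -(sum_card_translates A inj).
    apply: (@leq_trans (\sum_g ((g \in Q) * #|I| + k))).
      apply: leq_sum => g _; rewrite inE -/(N g); case: (leqP k #|N g|) => [_|/ltnW le].
        by apply: leq_trans (leq_addr _ _); rewrite mul1n max_card.
      by apply: leq_trans (leq_addl _ _).
    rewrite big_split /= -big_distrl /= sum_nat_const (mulnC k) leq_add2r leq_mul2r.
    apply/orP; right; rewrite -sum1_card [leqRHS]big_mkcond /=.
    by apply: leq_sum => g _; case: ifP.
  have H : #|I|%:R * (eps / 2 * #|G|%:R) <= #|I|%:R * #|Q|%:R.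
    have h1 := ler_wpM2l (ltW I_gt0) denseA.
    have h2 := ler_wpM2r (ler0n R #|G|) bigI.
    rewrite natrM in h2; rewrite [_ * #|I|%:R]mulrC in sumN.
    set q := #|I|%:R * #|Q|%:R in sumN *.
    have h3 : #|I|%:R * (eps * #|G|%:R) <= q + k%:R * #|G|%:R by apply: le_trans sumN.
    nra.
  by rewrite ler_pM2l in H.
pose c (T : {set I}) := #|[set g | [forall (i | i \in T), act i g \in A]]|.
suff /existsP[T /andP[/eqP cT leT]] : [exists T : {set I}, (#|T| == k) &&
    (eps / (2 * 2 ^+ #|I|) * #|G|%:R <= (c T)%:R)] by exists T.
apply: contraLR denseQ; rewrite negb_exists -ltNge => /forallP small.
have leQ : (#|Q| <= \sum_(T : {set I} | #|T| == k) c T)%N.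
  rewrite -sum1_card /c.
  under [leqRHS]eq_bigr do rewrite -sum1_card big_mkcond /=.
  rewrite exchange_big /= big_mkcond /=; apply: leq_sum => g _.
  case: ifP => //; rewrite inE => kN.
  have : (0 < #|[set T : {set I} | T \subset N g & #|T| == k]|)%N.
    by rewrite cards_draws bin_gt0.
  case/card_gt0P => T; rewrite inE => /andP[TN cT].
  rewrite (bigD1 T) //= inE; case: ifP => // /negP[].
  by apply/forall_inP => i iT; have := subsetP TN i iT; rewrite inE.
apply: le_lt_trans (_ : (\sum_(T : {set I} | #|T| == k) c T)%:R < _).
  by rewrite ler_nat.
pose b : R := eps / (2 * 2 ^+ #|I|) * #|G|%:R.
have b_gt0 : 0 < b by rewrite mulr_gt0 ?ltr0n // divr_gt0 // mulr_gt0 ?exprn_gt0.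
have -> : eps / 2 * #|G|%:R = \sum_(T : {set I}) b.
  have cI : #|{: {set I}}| = (2 ^ #|I|)%N.
    transitivity #|powerset [set: I]|; first by rewrite powersetT cardsT.
    by rewrite card_powerset cardsT.
  rewrite sumr_const cI -[RHS]mulr_natl natrX /b.
  by field; rewrite expf_neq0 ?pnatr_eq0.
rewrite natr_sum big_mkcond /=; apply: ltr_sum.
  by apply/hasP; exists set0; rewrite ?mem_index_enum.
move=> T _; have := small T; case: ifP => //= _.
by rewrite -ltNge.
Qed.

(** * The tripartite pattern on blocks of coordinates *)

Section TripartitePattern.

Variables (K M : nat).

(** [K] blocks of [M + 1] coordinates; a function [g] picks one coordinate in every block. *)
Let coord := ('I_K * 'I_M.+1)%type.
Let n := #|{: coord}|.
Implicit Types (x y : cube n) (g : {ffun 'I_K -> 'I_M.+1}) (i j : 'I_K) (a b : 'I_M.+1).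

Definition xorc x y : cube n := [ffun c => x c (+) y c].

Definition transversal_but i g : cube n :=
  [ffun c => let jk : coord := enum_val c in (jk.1 != i) && (g jk.1 == jk.2)].

(** Cyclic addition in ['I_M.+1] makes every shift injective, as [dense_common_translates]
    requires. *)
Definition shift j a g : {ffun 'I_K -> 'I_M.+1} :=
  [ffun l => if l == j then g l + a else g l].

Lemma xorc_inj y : injective (xorc^~ y).
Proof.
move=> x x' /ffunP E; apply/ffunP => c; have := E c; rewrite !ffunE.
exact: addIb.
Qed.

Lemma shift_inj j a : injective (shift j a).
Proof.
move=> g h /ffunP E; apply/ffunP => l; have := E l; rewrite !ffunE.
by case: eqP => // _ /addIr.
Qed.

Lemma transversal_butE i g j a :
  transversal_but i g (enum_rank (j, a)) = (j != i) && (g j == a).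
Proof. by rewrite ffunE enum_rankK. Qed.

(* The eight points are the edges of the complete tripartite graph with parts
   [{(i1, a1), (i1, a2)}], [{(i2, b1), (i2, b2)}] and [{(i3, g i3)}], relative
   to the common part of the transversals. *)
Lemma eight_points (C : {set cube n}) x g i1 i2 i3 a1 a2 b1 b2 :
  i1 != i2 -> i2 != i3 -> i3 != i1 -> a1 != a2 -> b1 != b2 ->
  (forall i a b, i \in [:: i1; i2; i3] -> a \in [:: a1; a2] ->
    b \in [:: b1; b2] ->
    xorc x (transversal_but i (shift i1 a (shift i2 b g))) \in C) ->
  exists (S : {set 'I_n}) (y : cube n), #|S| = 5%N /\ (8 <= #|C :&: subcube S y|)%N.
Proof.
move=> n12 n23 n31 na nb inC.
pose e j a : 'I_n := enum_rank ((j, a) : coord).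
have eE j a j' a' : (e j a == e j' a') = (j == j') && (a == a').
  by rewrite (inj_eq enum_rank_inj) xpair_eqE.
have addE (c a b : 'I_M.+1) : (c + a == c + b) = (a == b) by apply: (inj_eq (addrI c)).
(* The five free coordinates are the vertices of the graph. *)
pose s := [:: e i1 (g i1 + a1); e i1 (g i1 + a2);
              e i2 (g i2 + b1); e i2 (g i2 + b2); e i3 (g i3)].
have neqs := (negbTE n12, negbTE n23, negbTE n31, negbTE na, negbTE nb).
have sw (U : eqType) (u v : U) : u != v -> (v == u) = false.
  by rewrite eq_sym => /negbTE.
have neqs' := (sw _ _ _ n12, sw _ _ _ n23, sw _ _ _ n31, sw _ _ _ na, sw _ _ _ nb).
pose p i a b := xorc x (transversal_but i (shift i1 a (shift i2 b g))).
have sh1 a b : shift i1 a (shift i2 b g) i1 = g i1 + a.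
  by rewrite !ffunE eqxx neqs.
have sh2 a b : shift i1 a (shift i2 b g) i2 = g i2 + b.
  by rewrite !ffunE eqxx neqs'.
have sh3 a b : shift i1 a (shift i2 b g) i3 = g i3.
  by rewrite !ffunE neqs neqs'.
have pE i a b j k : x (e j k) (+) p i a b (e j k) =
    (j != i) && (shift i1 a (shift i2 b g) j == k).
  by rewrite ffunE addbA addbb transversal_butE.
(* The base point: [x] plus the part of the transversal outside the three blocks. *)
pose y : cube n := [ffun c => let jk : coord := enum_val c in
  x c (+) ((jk.1 \notin [:: i1; i2; i3]) && (g jk.1 == jk.2))].
exists [set c in s], y; split.
  rewrite cardsE -[5%N]/(size s); apply/card_uniqP.
  by rewrite /= !inE !eE !addE !eqxx !neqs !neqs' /=.
(* Omitting [i3] gives the four edges between the first two parts. Omitting [i2] or [i1] gives two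
   edges at the third part, with [b1] or [a1] as default for the other shift. *)
pose ps := [:: p i3 a1 b1; p i3 a1 b2; p i3 a2 b1; p i3 a2 b2;
               p i2 a1 b1; p i2 a2 b1; p i1 a1 b1; p i1 a1 b2].
have ups : uniq ps.
  (* [ev] reads off the incidence vector of an edge on the five vertices. *)
  pose ev (z : cube n) := [seq x c (+) z c | c <- s].
  have evE i a b : ev (p i a b) =
      [:: (i1 != i) && (a == a1); (i1 != i) && (a == a2);
          (i2 != i) && (b == b1); (i2 != i) && (b == b2); i3 != i].
    by rewrite /ev /s /= !pE sh1 sh2 sh3 !addE eqxx andbT.
  apply: (@map_uniq _ _ ev).
  by rewrite /= !evE !eqxx !neqs !neqs'.
have <- : #|ps| = 8%N by rewrite (card_uniqP ups).
apply: subset_leq_card.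
have psS i a b : i \in [:: i1; i2; i3] -> a \in [:: a1; a2] ->
    b \in [:: b1; b2] -> p i a b \in C :&: subcube [set c in s] y.
  move=> iI aI bI; rewrite inE inC //= inE; apply/forallP => c; apply/implyP.
  rewrite -(enum_valK c); case: (enum_val c) => j k; rewrite inE -/(e j k) => cs.
  rewrite /y !ffunE !enum_rankK /=; apply/eqP; congr (_ (+) _).
  move: cs; rewrite !inE !eE; case: (eqVneq j i1) => [->|j1].
    rewrite sh1 neqs neqs' /= orbF => kN; rewrite [g i1 + a == k]eq_sym.
    by move: aI kN; rewrite !inE => /orP[]/eqP-> /norP[/negbTE k1 /negbTE k2];
      rewrite ?k1 ?k2 andbF.
  case: (eqVneq j i2) => [->|j2].
    rewrite sh2 neqs /= orbF => kN; rewrite [g i2 + b == k]eq_sym.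
    by move: bI kN; rewrite !inE => /orP[]/eqP-> /norP[/negbTE k1 /negbTE k2];
      rewrite ?k1 ?k2 andbF.
  case: (eqVneq j i3) => [->|j3] /= kN.
    by rewrite sh3 [g i3 == k]eq_sym (negbTE kN) andbF.
  have -> : j != i by move: iI; rewrite !inE => /or3P[]/eqP->.
  by rewrite !ffunE (negbTE j1) (negbTE j2).
have /allP psC : all [in C :&: subcube [set c in s] y] ps.
  by rewrite /= !psS // !inE eqxx ?orbT.
by apply/subsetP => z /psC.
Qed.

End TripartitePattern.

(** Three rounds of [dense_common_translates] on pairs of a word and a transversal choose three
    blocks, two shifts in the first block and two in the second. *)
Lemma eight_codewords (R : realType) (eps : R) : 0 < eps ->
  exists n, forall C : {set cube n}, eps * 2 ^+ n <= #|C|%:R ->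
    exists (S : {set 'I_n}) (y : cube n), #|S| = 5%N /\ (8 <= #|C :&: subcube S y|)%N.
Proof.
have large (c : R) k : 0 < c -> exists m : nat, k%:R <= c * m%:R.
  move=> c0; exists (Num.bound (k%:R / c)); rewrite mulrC -ler_pdivrMr //.
  by rewrite ltW // archi_boundP // divr_ge0 // ltW.
have shrink (c : R) k : 0 < c -> 0 < c / (2 * 2 ^+ k).
  by move=> c0; rewrite divr_gt0 // mulr_gt0 // exprn_gt0.
move=> eps0; have [K K_large] := large eps (2 * 3)%N eps0.
pose d1 := eps / (2 * 2 ^+ K); have d1_gt0 : 0 < d1 by apply: shrink.
have [m m_large] := large d1 (2 * 2)%N d1_gt0.
pose d2 := d1 / (2 * 2 ^+ m); have d2_gt0 : 0 < d2 by apply: shrink.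
have [M' M'_large] := large d2 (2 * 2)%N d2_gt0.
pose M := (m + M')%N; exists #|{: 'I_K * 'I_M.+1}| => C denseC.
pose G := (cube #|{: 'I_K * 'I_M.+1}| * {ffun 'I_K -> 'I_M.+1})%type.
have G_gt0 : (0 < #|{: G}|)%N.
  by apply/card_gt0P; exists ([ffun=> false], [ffun=> ord0]).
pose A : {set G} := finset.setX C [set: _].
have denseA : eps * #|{: G}|%:R <= #|A|%:R.
  rewrite cardsX card_prod cardsT !natrM mulrA ler_wpM2r //.
  by rewrite card_ffun card_bool card_ord natrX.
pose act1 i (xg : G) : G := (xorc xg.1 (transversal_but i xg.2), xg.2).
have inj1 i : injective (act1 i).
  by move=> [x g] [x' g'] [E gg']; subst g'; rewrite (xorc_inj E).
have [|T1 [cT1 denseT1]] := dense_common_translates inj1 eps0 (isT : (0 < 3)%N) G_gt0 denseA.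
  by rewrite card_ord.
rewrite card_ord -/d1 in denseT1.
have /card_gt2P[i1 [i2 [i3 [[i1T i2T i3T] [n12 n23 n31]]]]] : (2 < #|T1|)%N by rewrite cT1.
(* Only [m] shifts are tried here, so that [d2] is known before [M], which has to be large in terms
   of [d2]. *)
pose act2 (a : 'I_m) (xg : G) : G := (xg.1, shift i1 (inord a) xg.2).
have inj2 a : injective (act2 a).
  by move=> [x g] [x' g'] [-> gg']; rewrite (shift_inj gg').
have [|T2 [cT2 denseT2]] := dense_common_translates inj2 d1_gt0 (isT : (0 < 2)%N) G_gt0 denseT1.
  by rewrite card_ord.
rewrite card_ord -/d2 in denseT2.
have /card_gt1P[a1 [a2 [a1T a2T na]]] : (1 < #|T2|)%N by rewrite cT2.
pose act3 (b : 'I_M.+1) (xg : G) : G := (xg.1, shift i2 b xg.2).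
have inj3 b : injective (act3 b).
  by move=> [x g] [x' g'] [-> gg']; rewrite (shift_inj gg').
have [|T3 [cT3 denseT3]] := dense_common_translates inj3 d2_gt0 (isT : (0 < 2)%N) G_gt0 denseT2.
  rewrite card_ord; apply: le_trans M'_large _; rewrite ler_wpM2l ?(ltW d2_gt0) //.
  by rewrite ler_nat leqW // leq_addl.
have /card_gt1P[b1 [b2 [b1T b2T nb]]] : (1 < #|T3|)%N by rewrite cT3.
have : 0 < #|[set xg : G | [forall (b | b \in T3), act3 b xg \in
    [set xg : G | [forall (a | a \in T2), act2 a xg \in
    [set xg : G | [forall (i | i \in T1), act1 i xg \in A]]]]]]|%:R :> R.
  by apply: lt_le_trans denseT3; rewrite mulr_gt0 ?ltr0n // shrink.
rewrite ltr0n => /card_gt0P[[x g]]; rewrite inE => /forall_inP gC.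
apply: (@eight_points K M C x g i1 i2 i3 (inord a1) (inord a2) b1 b2 n12 n23 n31 _ nb).
  apply: contra_neq na => /(congr1 val) /=; rewrite !inordK => [/val_inj //||].
    exact: leq_trans (ltnW (ltn_ord a2)) (leq_addr _ _).
  exact: leq_trans (ltnW (ltn_ord a1)) (leq_addr _ _).
have iT i : i \in [:: i1; i2; i3] -> i \in T1.
  by rewrite !inE => /or3P[]/eqP->.
have bT b : b \in [:: b1; b2] -> b \in T3 by rewrite !inE => /orP[]/eqP->.
move=> i a b /iT {}iT aI /bT {}bT.
have {aI} [a' aT ->] : exists2 a', a' \in T2 & a = inord a'.
  by move: aI; rewrite !inE => /orP[]/eqP->; [exists a1|exists a2].
have := gC b bT; rewrite inE => /forall_inP /(_ a' aT).
rewrite inE => /forall_inP /(_ i iT).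
by rewrite !inE andbT.
Qed.

Lemma dense_codes5_ge8 (R : realType) L : has_dense_codes R 5 L -> (8 <= L)%N.
Proof.
case=> eps [/eight_codewords[n eight] /(_ n)[C [codeC denseC]]].
have [S [y [cS le8]]] := eight C denseC.
by apply: leq_trans le8 (codeC S y cS).
Qed.

(** * Numerical estimates *)

Lemma bernoulli_ineq (R : realFieldType) (x : R) k :
  0 <= x <= 1 -> 1 - k%:R * x <= (1 - x) ^+ k.
Proof.
move=> /andP[x0 x1]; elim: k => [|k IH]; first by rewrite mul0r subr0 expr0.
have h := ler_wpM2l (_ : 0 <= 1 - x) IH; rewrite exprS.
apply: le_trans (h _); last by rewrite subr_ge0.
have k0 : 0 <= k%:R * x ^+ 2 by rewrite mulr_ge0 ?sqr_ge0.
by rewrite -natr1; nra.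
Qed.

Lemma expn_le_ffact d t k : (k <= t)%N -> ((d - t) ^ k <= d ^_ k)%N.
Proof.
elim: k => // k IH lt_kt; rewrite ffactnSr expnSr.
by apply: leq_mul; [apply/IH/ltnW | apply/leq_sub2l/ltnW].
Qed.

Lemma leq_bin_succ d t : (t.*2 < d)%N -> ('C(d, t) <= 'C(d, t.+1))%N.
Proof.
move=> lt_td; rewrite -(leq_pmul2l (ltn0Sn t)) mul_bin_left leq_mul2r.
by apply/orP; right; rewrite ltn_subRL -addnn in lt_td *; lia.
Qed.

Lemma leq_bin_half d t : ('C(d, t) <= 'C(d, d %/ 2))%N.
Proof.
have low k s : (s + k = d %/ 2)%N -> ('C(d, s) <= 'C(d, d %/ 2))%N.
  elim: k s => [|k IH] s; first by rewrite addn0 => ->.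
  move=> sk; apply: leq_trans (IH s.+1 _); last by rewrite addSnnS.
  by apply: leq_bin_succ; lia.
have [lt_dt|le_td] := ltnP d t; first by rewrite bin_small.
have [le|lt] := leqP t (d %/ 2); first by apply: (low (d %/ 2 - t)%N); lia.
rewrite -bin_sub //; apply: (low (d %/ 2 - (d - t))%N); lia.
Qed.

(** While [3 * s + 2 <= d], passing from [s] to [s + 1] at least doubles the coefficient; two steps
    give 4. As [c > 1 / 4], the trivial bound ['C(d, t)] is then good enough. *)
Lemma bin_far_from_half d t :
  (3 * t + 5 <= d)%N || (3 * (d - t) + 5 <= d)%N -> (4 * 'C(d, t) <= 'C(d, d %/ 2))%N.
Proof.
have double s : (3 * s + 2 <= d)%N -> (2 * 'C(d, s) <= 'C(d, s.+1))%N.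
  move=> le; rewrite -(leq_pmul2l (ltn0Sn s)) mul_bin_left mulnA leq_mul2r.
  by apply/orP; right; lia.
have low s : (3 * s + 5 <= d)%N -> (4 * 'C(d, s) <= 'C(d, d %/ 2))%N.
  move=> le; apply: leq_trans (leq_bin_half d s.+2).
  have h1 : (3 * s + 2 <= d)%N by lia.
  have h2 : (3 * s.+1 + 2 <= d)%N by lia.
  by have := double _ h1; have := double _ h2; lia.
case/orP => [/low //|le].
have [lt_dt|le_td] := ltnP d t; first by rewrite bin_small.
by rewrite -bin_sub // low.
Qed.

(** * Bounds on [c_seq] through a finite Euler product *)

Section CSeqBounds.

Variable R : realType.

Definition euler_prod (t : nat) : R := \prod_(1 <= i < t) (1 - (2 ^+ i)^-1).

Lemma pow2_gt0 k : 0 < 2 ^+ k :> R. Proof. by rewrite exprn_gt0. Qed.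

Lemma c_seqE t : c_seq R t = euler_prod t / (1 - (2 ^+ t)^-1) ^+ t.-1.
Proof.
case: t => [|t]; first by rewrite /c_seq /euler_prod !big_geq // !expr0 !divr1.
rewrite /c_seq; have -> : \prod_(1 <= i < t.+1) (2 ^+ t.+1 - 2 ^+ i) =
          (2 ^+ t.+1) ^+ t * euler_prod t.+1 :> R.
  have -> : (2 ^+ t.+1) ^+ t = \prod_(1 <= i < t.+1) 2 ^+ t.+1 :> R.
    by rewrite prodr_const_nat subn1.
  rewrite /euler_prod big_nat_rev -big_split /=; apply: eq_big_nat => i /andP[i1 it].
  rewrite add1n subSS mulrBr mulr1; congr (_ - _).
  by rewrite expfB.
have p_gt0 : 0 < 2 ^+ t.+1 - 1 :> R by rewrite subr_gt0 exprn_egt1 // ltr1n.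
have -> : 1 - (2 ^+ t.+1)^-1 = (2 ^+ t.+1 - 1) / 2 ^+ t.+1 :> R.
  by rewrite mulrBl divff ?mul1r // gt_eqF // pow2_gt0.
rewrite /= exprMn exprVn; set P := _ ^+ t; set Q := _ ^+ t.
have P0 : P != 0 by rewrite expf_neq0 // gt_eqF // pow2_gt0.
have Q0 : Q != 0 by rewrite expf_neq0 // gt_eqF.
by field; rewrite P0 Q0.
Qed.

Lemma euler_prod_ge0 t : 0 <= euler_prod t.
Proof.
apply: prodr_ge0 => i _; rewrite subr_ge0 invf_le1 ?pow2_gt0 //.
by rewrite exprn_ege1 // ler1n.
Qed.

Lemma euler_prodS t : (0 < t)%N ->
  euler_prod t.+1 = euler_prod t * (1 - (2 ^+ t)^-1).
Proof. by move=> t0; rewrite /euler_prod big_nat_recr. Qed.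

Lemma euler_prodD_le s k : (0 < s)%N -> euler_prod (s + k) <= euler_prod s.
Proof.
move=> s0; elim: k => [|k IH]; first by rewrite addn0.
rewrite addnS euler_prodS ?addn_gt0 ?s0 //; apply: le_trans IH.
by rewrite ler_piMr ?euler_prod_ge0 // lerBlDr lerDl invr_ge0 ltW ?pow2_gt0.
Qed.

(** A product of factors [1 - u_i] is at least [1] minus the sum of the [u_i], here a geometric
    sum. *)
Lemma euler_prodD_ge s k : (0 < s)%N ->
  euler_prod s * (1 - 2 / 2 ^+ s + 2 / 2 ^+ (s + k)) <= euler_prod (s + k).
Proof.
move=> s0; elim: k => [|k IH]; first by rewrite addn0 subrK mulr1.
rewrite addnS euler_prodS ?addn_gt0 ?s0 //.
have p1 := pow2_gt0 s; have p2 := pow2_gt0 (s + k).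
have a1 : 1 <= 2 ^+ (s + k) :> R by rewrite exprn_ege1 // ler1n.
have ab : 2 ^+ s <= 2 ^+ (s + k) :> R by rewrite ler_eXn2l ?ltr1n // leq_addr.
set u := (2 ^+ (s + k))^-1; have u0 : 0 <= u by rewrite invr_ge0 ltW.
have u1 : 0 <= 1 - u by rewrite subr_ge0 invf_le1.
apply: le_trans (ler_wpM2r u1 IH); rewrite -mulrA ler_wpM2l ?euler_prod_ge0 //.
rewrite exprS invfM -/u; set v := (2 ^+ s)^-1.
have uv : u <= v by rewrite lef_pV2.
have -> : 2 * (2^-1 * u) = u by field.
have : 0 <= u * (v - u) by rewrite mulr_ge0 // subr_ge0.
by nra.
Qed.

Lemma euler_prod8 : 29%:R / 100%:R <= euler_prod 8 <= 293%:R / 1000%:R.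
Proof.
rewrite 7?euler_prodS // {1 2}/euler_prod !big_geq // -!natrX.
by apply/andP; split; lra.
Qed.

Lemma c_seqS_le t : c_seq R t.+1 <= c_seq R t.
Proof.
rewrite c_seqS ler_piMr ?c_seq_ge0 // exprn_ile1 //.
  rewrite subr_ge0 invf_le1; last by rewrite subr_gt0 exprn_egt1 // ltr1n.
  by rewrite lerBrDr exprS mulr_natl mulr2n lerD // exprn_ege1 // ler1n.
by rewrite lerBlDr lerDl invr_ge0 subr_ge0 exprn_ege1 // ler1n.
Qed.

Lemma c_seq_le s t : (s <= t)%N -> c_seq R t <= c_seq R s.
Proof.
move=> /subnKC <-; elim: (t - s)%N => [|k IH]; first by rewrite addn0.
by rewrite addnS; apply: le_trans (c_seqS_le _) IH.
Qed.

(** By monotonicity indices from 8 on suffice. There the denominator in [c_seqE] is at most 1, and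
    the tail of the product costs at most a factor [1 - 1 / 128]. *)
Lemma c_seq_lower t : 285%:R / 1000%:R <= c_seq R t.
Proof.
apply: le_trans (c_seq_le (leq_addl 8 t)); rewrite c_seqE.
apply: le_trans (_ : euler_prod (8 + t) <= _).
  apply: le_trans (euler_prodD_ge t (isT : (0 < 8)%N)).
  have /andP[lo _] := euler_prod8.
  have : 0 <= 2 / 2 ^+ (8 + t) :> R by rewrite divr_ge0 // ltW // pow2_gt0.
  have -> : 2 / 2 ^+ 8 = 128%:R^-1 :> R by rewrite !exprS expr0; field.
  by set w := 2 / _; nra.
rewrite ler_peMr ?euler_prod_ge0 //.
have p1 : 1 < 2 ^+ (8 + t) :> R by rewrite exprn_egt1 // ltr1n.
rewrite invf_ge1; last by rewrite exprn_gt0 // subr_gt0 invf_lt1 // (lt_trans _ p1).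
rewrite exprn_ile1 //.
  by rewrite subr_ge0 invf_le1 ?(ltW p1) // (lt_trans _ p1).
by rewrite lerBlDr lerDl invr_ge0 ltW // (lt_trans _ p1).
Qed.

(** The Euler product is below 0.293, and at index 11 the denominator is at least
    [1 - 10 / 2048]. *)
Lemma c_seq11_le : c_seq R 11 <= 295%:R / 1000%:R.
Proof.
have x2 : (2 ^+ 11)^-1 = 2048%:R^-1 :> R by rewrite -natrX.
have x01 : 0 <= (2048%:R^-1 : R) <= 1 by lra.
rewrite c_seqE x2 /=; have := bernoulli_ineq 10 x01.
set D := _ ^+ 10 => leD; have D0 : 0 < D by lra.
rewrite ler_pdivrMr //; have /andP[_ hi] := euler_prod8.
have := euler_prodD_le 3 (isT : (0 < 8)%N); rewrite /=.
by lra.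
Qed.

End CSeqBounds.

(** * Bounds on [Lmin] *)

From mathcomp Require Import all_classical all_reals all_analysis.
Import numFieldNormedType.Exports.
Local Open Scope classical_set_scope.
Local Open Scope ring_scope.

Section Bounds.

Variable R : realType.

Lemma Lmin_le d L : has_dense_codes R d L -> (Lmin R d <= L)%N.
Proof. by move=> dense; rewrite /Lmin; case: ex_minnP => m _; apply; apply/asboolP. Qed.

Lemma Lmin_dense d : has_dense_codes R d (Lmin R d).
Proof. by rewrite /Lmin; case: ex_minnP => m /asboolP. Qed.

(** The number of completions is an integer, so a ratio can be rounded down before it is
    propagated. *)
Lemma completions_le_nat (rho rho' : R) d t (L : nat) :
  rho * 'C(d, t)%:R < L.+1%:R -> L%:R <= rho' * 'C(d, t)%:R ->
  completions_le rho d t -> completions_le rho' d t.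
Proof.
move=> lt_L le_L H n r A S D cD dis rE; apply: le_trans le_L.
by rewrite ler_nat -ltnS -(ltr_nat R); apply: le_lt_trans (H _ _ _ _ _ cD dis rE) lt_L.
Qed.

Lemma completions_le_add (rho : R) d t j l :
  (t <= d)%N -> completions_le rho d t -> completions_le rho (d + j + l) (t + j).
Proof.
move=> le_td H; elim: l => [|l IH].
  rewrite addn0; elim: j => [|j IH]; first by rewrite !addn0.
  by rewrite !addnS; apply: completions_le_contr.
by rewrite addnS; apply: completions_le_del => //; rewrite -addnA leq_add // leq_addr.
Qed.

Lemma Lmin_le_completions (rho : R) d L :
  (forall t, (t <= d)%N -> ('C(d, t) <= L)%N \/
     rho * 'C(d, t)%:R < L.+1%:R /\ completions_le rho d t) ->
  (Lmin R d <= L)%N.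
Proof.
move=> H; apply: Lmin_le; apply: dense_codes_of_completions.
move=> t r n A S D le_td cD dis rE.
case: (H t le_td) => [|[le_L cle]].
  by apply: leq_trans; rewrite -cD; apply: card_completions_le.
by rewrite -ltnS -(ltr_nat R); apply: le_lt_trans (cle _ _ _ _ _ cD dis rE) le_L.
Qed.

Lemma completions_le42 : completions_le (5%:R / 6%:R : R) 4 2.
Proof.
(* The Lagrangian bound [2 / 3 * 4 ^ 2 = 32 / 3] is [8 / 9] of [4 ^_ 2 = 12]; and [8 / 9] of the 6
   pairs is below 6, which leaves 5. *)
apply: (@completions_le_nat (8%:R / 9%:R) _ _ _ 5).
- by rewrite (_ : 'C(4, 2) = 6%N) //; lra.
- by rewrite (_ : 'C(4, 2) = 6%N) //; lra.
apply: completions_le_lagrangian => //.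
have -> : c_seq R 2 = 2%:R / 3%:R by rewrite /c_seq big_nat1 expr1 -!natrX; field.
by rewrite (_ : 4 ^_ 2 = 12)%N // -natrX; lra.
Qed.

Lemma completions_le52 : completions_le (4%:R / 5%:R : R) 5 2.
Proof.
apply: (@completions_le_nat (5%:R / 6%:R) _ _ _ 8).
- by rewrite (_ : 'C(5, 2) = 10%N) //; lra.
- by rewrite (_ : 'C(5, 2) = 10%N) //; lra.
by apply: completions_le_del => //; apply: completions_le42.
Qed.

Lemma completions_le53 : completions_le (4%:R / 5%:R : R) 5 3.
Proof.
apply: (@completions_le_nat (5%:R / 6%:R) _ _ _ 8).
- by rewrite (_ : 'C(5, 3) = 10%N) //; lra.
- by rewrite (_ : 'C(5, 3) = 10%N) //; lra.
by apply: completions_le_contr; apply: completions_le42.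
Qed.

Lemma Lmin5_le : (Lmin R 5 <= 8)%N.
Proof.
apply: (@Lmin_le_completions (4%:R / 5%:R)).
case=> [|[|[|[|[|[|//]]]]]] _; try by left.
- right; split; last exact: completions_le52.
  by rewrite (_ : 'C(5, 2) = 10%N) //; lra.
- right; split; last exact: completions_le53.
  by rewrite (_ : 'C(5, 3) = 10%N) //; lra.
Qed.

Lemma completions_le63 : completions_le (4%:R / 5%:R : R) 6 3.
Proof. by apply: completions_le_del => //; apply: completions_le53. Qed.

Lemma Lmin6_le : (Lmin R 6 <= 16)%N.
Proof.
apply: (@Lmin_le_completions (4%:R / 5%:R)).
case=> [|[|[|[|[|[|[|//]]]]]]] _; try by left.
right; split; last exact: completions_le63.
by rewrite (_ : 'C(6, 3) = 20%N) //; lra.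
Qed.

(** [4 / 5] of ['C(7, 3) = 35] is exactly 28; for [t] other than 3 and 4, ['C(7, t)] is at most
    21. *)
Lemma Lmin7_le : (Lmin R 7 <= 28)%N.
Proof.
apply: (@Lmin_le_completions (4%:R / 5%:R)).
case=> [|[|[|[|[|[|[|[|//]]]]]]]] _; try by left.
- right; split; last by apply: completions_le_del => //; apply: completions_le63.
  by rewrite (_ : 'C(7, 3) = 35%N) //; lra.
- right; split; last by apply: completions_le_contr; apply: completions_le63.
  by rewrite (_ : 'C(7, 4) = 35%N) //; lra.
Qed.

End Bounds.

(** * The asymptotic bound *)

Section Asymptotics.

Variable R : realType.

Lemma c_seq_nonincreasing : {homo c_seq R : n m / (n <= m)%N >-> m <= n}.
Proof. by move=> n m; apply: c_seq_le. Qed.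

Lemma c_seq_is_cvg : cvgn (c_seq R).
Proof.
apply: nonincreasing_is_cvgn; first exact: c_seq_nonincreasing.
by exists 0 => _ [t _ <-]; apply: c_seq_ge0.
Qed.

Lemma c_lim_lower : 285%:R / 1000%:R <= limn (c_seq R).
Proof. by apply: limr_ge; [exact: c_seq_is_cvg|near=> t; apply: c_seq_lower].
Unshelve. all: by end_near. Qed.

Lemma c_lim_le_c_seq t : limn (c_seq R) <= c_seq R t.
Proof. exact: (nonincreasing_cvgn_ge c_seq_nonincreasing c_seq_is_cvg). Qed.

(** Take [t] with [c_seq t < rho]; for large [d] the quotient of [d ^ t] by [d ^_ t] is close to 1,
    and the Lagrangian bound applies. *)
Lemma completions_le_eventually (rho : R) : limn (c_seq R) < rho ->
  exists d t, (t <= d)%N /\ completions_le rho d t.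
Proof.
move=> lt_rho; have lim_gt0 : 0 < limn (c_seq R).
  by apply: lt_le_trans c_lim_lower; rewrite divr_gt0 ?ltr0n.
have rho_gt0 := lt_trans lim_gt0 lt_rho.
have [t ct] : exists t, c_seq R t < rho.
  have /cvgrPdist_lt/(_ _ (_ : 0 < rho - limn (c_seq R))) := c_seq_is_cvg.
  rewrite subr_gt0 => /(_ lt_rho)[t _ /(_ t (leqnn t))] /=.
  by rewrite distrC ltr_distl => /andP[_]; rewrite addrC subrK; exists t.
pose gap := rho - c_seq R t; have gap_gt0 : 0 < gap by rewrite subr_gt0.
(* Large enough for [gap * d] to absorb the Bernoulli loss [rho * t ^ 2]. *)
pose d := (t + Num.bound (rho * (t * t)%:R / gap)).+1%N.
have le_td : (t <= d)%N by rewrite /d -addnS leq_addr.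
have d_gt0 : 0 < d%:R :> R by rewrite ltr0n.
exists d, t; split=> //; apply: completions_le_lagrangian => //.
have large : rho * (t * t)%:R <= gap * d%:R.
  rewrite -ler_pdivrMl // [gap^-1 * _]mulrC.
  apply: le_trans (_ : (Num.bound (rho * (t * t)%:R / gap))%:R <= _).
    by apply/ltW/archi_boundP/divr_ge0; [apply: mulr_ge0 => //|]; apply: ltW.
  by rewrite ler_nat /d -addnS -addSnnS leq_addl.
apply: le_trans (_ : rho * ((d - t) ^ t)%:R <= _); last first.
  by apply: ler_wpM2l; rewrite ?ler_nat ?expn_le_ffact //; apply: ltW.
have -> : ((d - t) ^ t)%:R = d%:R ^+ t * (1 - t%:R / d%:R) ^+ t :> R.
  by rewrite natrX -exprMn mulrBr mulr1 mulrCA divff ?mulr1 ?natrB // gt_eqF.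
rewrite mulrCA [leRHS]mulrC ler_wpM2r ?exprn_ge0 //.
have x01 : 0 <= (t%:R / d%:R : R) <= 1.
  by rewrite divr_ge0 //= ler_pdivrMr // mul1r ler_nat.
apply: le_trans (ler_wpM2l (ltW rho_gt0) (bernoulli_ineq t x01)).
rewrite mulrBr mulr1 lerBrDr -lerBrDl -/gap.
have -> : rho * (t%:R * (t%:R / d%:R)) = rho * (t * t)%:R / d%:R.
  by rewrite natrM !mulrA.
by rewrite ler_pdivrMr.
Qed.

Lemma Lmin_le_eventually (rho : R) : limn (c_seq R) < rho ->
  \forall d \near \oo, (Lmin R d)%:R <= rho * 'C(d, d %/ 2)%:R.
Proof.
move=> lt_rho; have [d0 [t0 [le_td0 cle]]] := completions_le_eventually lt_rho.
have rho4 : 4%:R^-1 <= rho.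
  by apply: le_trans (ltW lt_rho); apply: le_trans c_lim_lower; lra.
(* If [t] is not far from the middle, this makes both [t] and [d - t] exceed [d0], so [(d, t)] is
   reached from [(d0, t0)] by contractions and deletions. *)
exists (3 * d0 + 5)%N => // d /= le_d.
have rho_ge0 : 0 <= rho by apply: le_trans rho4; rewrite invr_ge0.
pose x := rho * 'C(d, d %/ 2)%:R; have x_ge0 : 0 <= x by rewrite mulr_ge0.
rewrite -(truncn_ge_nat _ x_ge0); apply: (@Lmin_le_completions _ rho) => t le_t.
have [far|near] := boolP ((3 * t + 5 <= d)%N || (3 * (d - t) + 5 <= d)%N).
  left; rewrite truncn_ge_nat // /x.
  have := bin_far_from_half far; rewrite -(ler_nat R) natrM => le4.
  apply: le_trans (ler_wpM2r (ler0n _ _) rho4).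
  by rewrite mulrC ler_pdivlMr // mulrC.
right; split.
  rewrite -truncn_le_nat; apply: le_truncn.
  by apply: ler_wpM2l => //; rewrite ler_nat leq_bin_half.
have [j tE] : exists j, t = (t0 + j)%N by exists (t - t0)%N; lia.
have [l dE] : exists l, d = (d0 + j + l)%N by exists (d - (d0 + j))%N; lia.
by rewrite tE dE; apply: completions_le_add.
Qed.

End Asymptotics.

Theorem theorem1p3 (R : realType) :
  [/\ Lmin R 5 = 8%N,
      (Lmin R 6 <= 16)%N,
      (Lmin R 7 <= 28)%N
    & exists c : R,
        [/\ c_seq R t @[t --> \oo] --> c,
            `|c - 29%:R / 100%:R| <= 5%:R / 1000%:R
          & exists o : nat -> R,
              o d @[d --> \oo] --> (0 : R) /\
              forall d : nat,
                (Lmin R d)%:R <= (c + o d) * ('C(d, d %/ 2))%:R]].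
Proof.
split; [|exact: Lmin6_le|exact: Lmin7_le|].
  apply/eqP; rewrite eqn_leq Lmin5_le /=.
  exact: dense_codes5_ge8 (Lmin_dense R 5).
exists (limn (c_seq R)); split; first exact: c_seq_is_cvg.
  have lo := c_lim_lower R; have hi := le_trans (c_lim_le_c_seq R 11) (c_seq11_le R).
  by rewrite ler_distl; apply/andP; split; lra.
pose b d : R := 'C(d, d %/ 2)%:R.
have b_gt0 d : 0 < b d by rewrite ltr0n bin_gt0 leq_div.
(* Truncation at 0 keeps the inequality for every [d] and reduces convergence to an eventual upper
   bound on [Lmin]. *)
pose o d := Num.max 0 ((Lmin R d)%:R / b d - limn (c_seq R)).
exists o; split=> [|d]; last first.
  by rewrite -(ler_pdivrMr _ _ (b_gt0 d)) -lerBlDl le_max lexx orbT.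
apply/cvgr0Pnorm_le => e e_gt0.
have lt_e : limn (c_seq R) < limn (c_seq R) + e by rewrite ltrDl.
apply: filterS (Lmin_le_eventually lt_e) => d le_d.
rewrite ger0_norm ?le_max ?lexx // ge_max ltW //= lerBlDl.
by rewrite ler_pdivrMr.
Qed.
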